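(* Let $\{0,1\}^{\mathbb{N}}$ be equipped with the metric $\rho(x,y)=2^{-\min\{k\ge 1:\,x_k\ne y_k\}}$ (for $x\ne y$, and $\rho(x,x)=0$), and let $$X_0:=\bigl\{x\in\{0,1\}^{\mathbb{N}}:\ x_nx_{2n}=0\ \text{ for all } n\ge 1\bigr\}.$$ Let $(a_n)_{n\ge 0}$ be the Fibonacci sequence defined by $a_0=1$, $a_1=2$, and $a_n=a_{n-1}+a_{n-2}$ for $n\ge 2$. Then the box dimension of $X_0$ is $$\dim_B(X_0)=\frac{1}{2\log 2}\sum_{n=1}^{\infty}\frac{\log a_n}{2^n}=0.8242936\cdots.$$
   Context: $\mathbb{N}$ denotes the set of positive integers, and $x=(x_1,x_2,\dots)$ has coordinates $x_k\in\{0,1\}$. $\dim_B$ denotes the box-counting (Minkowski) dimension with respect to $\rho$; the assertion includes that the limit defining it exists. $\log$ is the natural logarithm. *)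

(* Defs.v *)
From HB Require Import structures.
From mathcomp Require Import all_boot all_order all_algebra.
From mathcomp Require Import all_classical all_reals all_analysis.
Set Implicit Arguments.
Unset Strict Implicit.
Unset Printing Implicit Defensive.
Import Order.TTheory GRing.Theory Num.Theory.
Import numFieldNormedType.Exports.
Local Open Scope classical_set_scope.
Local Open Scope ring_scope.

Section box_dimension.
Context (R : realType) (T : metricType R).
Implicit Types (A : set T) (d : R) (n : nat).

Definition diam_le A d := forall x y, A x -> A y -> mdist x y <= d.

Definition covered_by A d n := exists U : 'I_n -> set T,
  (forall i, diam_le (U i) d) /\ A `<=` \bigcup_i U i.

(* The least number of sets of diameter at most d that cover A; it is +oo
   when no finite cover of this kind exists. *)
Definition cover_number A d : \bar R :=
  ereal_inf [set n%:R%:E | n in covered_by A d].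

(* The limit d -> 0+ is over real d and takes place in \bar R. *)
Definition has_box_dim A (s : \bar R) :=
  (lne (cover_number A d) * ((- ln d)^-1)%:E)%E @[d --> 0^'+] --> s.

End box_dimension.

(* {0,1}^N with N the positive integers: the k-th coordinate, k >= 1, of x is
   stored at index k - 1.  The parameter R only fixes the codomain of the
   metric, so that the canonical metric structure can be inferred. *)
Definition binseq (R : realType) : Type := nat -> bool.

HB.instance Definition _ (R : realType) := Choice.copy (binseq R) (nat -> bool).

Definition nth_coord (R : realType) (x : binseq R) (k : nat) : bool := x k.-1.

Section binseq_metric.
Context (R : realType).
Implicit Types x y z : binseq R.

Definition differ_at x y (k : nat) : bool :=
  (0 < k)%N && (nth_coord x k != nth_coord y k).

Definition rho x y : R :=
  match pselect (exists k, differ_at x y k) with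
  | left xy => 2 ^- (ex_minn xy)
  | right _ => 0
  end.

Lemma rhoxx x : rho x x = 0.
Proof.
rewrite /rho; case: pselect => // xx; exfalso; case: xx => k.
by rewrite /differ_at eqxx andbF.
Qed.

Lemma rho_positivity x y : rho x y = 0 -> x = y.
Proof.
rewrite /rho; case: pselect => [xy|nxy] => [/eqP|_].
  by rewrite invr_eq0 expf_eq0 pnatr_eq0 andbF.
apply/funext => n; apply/eqP; apply: contra_notT nxy => xyn.
by exists n.+1.
Qed.

Lemma differ_at_sym x y : differ_at x y = differ_at y x.
Proof. by apply/funext => k; rewrite /differ_at eq_sym. Qed.

Lemma rho_sym x y : rho x y = rho y x.
Proof.
by rewrite /rho differ_at_sym; case: pselect.
Qed.

Lemma rho_ge0 x y : 0 <= rho x y.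
Proof. by rewrite /rho; case: pselect => // xy; rewrite invr_ge0 exprn_ge0. Qed.

Lemma rho_ge x y k : differ_at x y k -> 2 ^- k <= rho x y.
Proof.
move=> xyk; rewrite /rho; case: pselect => [xy|[]]; last by exists k.
case: ex_minnP => m _ /(_ _ xyk) mk.
by rewrite lef_pV2 ?posrE ?exprn_gt0// ler_eXn2l// ltr1n.
Qed.

Lemma rho_triangle y x z : rho x z <= rho x y + rho y z.
Proof.
rewrite {1}/rho; case: pselect => [xz|_]; last by rewrite addr_ge0 ?rho_ge0.
case: ex_minnP => m /andP[m0 xzm] _.
have [xym|xym] := eqVneq (nth_coord x m) (nth_coord y m).
  rewrite -[leLHS]add0r lerD ?rho_ge0// rho_ge// /differ_at m0/=.
  by rewrite -xym.
by rewrite -[leLHS]addr0 lerD ?rho_ge0// rho_ge// /differ_at m0.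
Qed.

HB.instance Definition _ := isMetric.Build R (binseq R)
  rhoxx rho_positivity rho_sym rho_triangle.

Definition X0 : set (binseq R) :=
  [set x | forall n, (0 < n)%N -> (nth_coord x n * nth_coord x (2 * n) = 0)%N].

End binseq_metric.

Fixpoint fibo (n : nat) : nat :=
  match n with
  | 0 => 1
  | 1 => 2
  | (m.+1 as p).+1 => fibo p + fibo m
  end.

(* Main.v *)
(** A word of length [n] is admissible when [x_k x_(2k) = 0] throughout.  The
    sets of diameter less than [2 ^ - n] separate different words of length [n],
    so for [2 ^ - n.+1 <= d < 2 ^ - n] the covering number is the number of
    admissible words of length [n].  The coordinates split into the
    independent chains [i, 2i, 4i, ...] with [i] odd, and a chain with [l]
    elements below [n] can be filled in [fibo l] ways.  Writing
    [ln (fibo l)] as a telescoping sum of increments and exchanging sums, the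
    [j]-th increment is counted by the odd [i <= n / 2 ^ j], about
    [n / 2 ^ j.+1] of them; dividing by [n] and summing by parts gives half of
    [\sum ln (fibo j) / 2 ^ j].  The tail of this series from [N.+1] on is at
    most [(N + 2) ln 2 / 2 ^ N], which leaves a finite computation for the
    decimal value. *)
Require Import Defs.
From Stdlib Require Import NArith.
From HB Require Import structures.
From mathcomp Require Import all_boot all_order all_algebra.
From mathcomp Require Import all_classical all_reals all_analysis.
From mathcomp Require Import zify ring lra.
Set Implicit Arguments.
Unset Strict Implicit.
Unset Printing Implicit Defensive.
Import Order.TTheory GRing.Theory Num.Theory.
Import numFieldNormedType.Exports.
Local Open Scope classical_set_scope.
Local Open Scope ring_scope.

(** * Admissible words *)

Section words.
Local Open Scope nat_scope.

(** Decides whether [true] may follow [s]: the new coordinate [(size s).+1] is constrained only by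
    its half, if it is even. The final [.-1] turns a coordinate into an index. *)
Definition free_letter (s : seq bool) : bool :=
  odd (size s).+1 || ~~ nth false s (size s).+1./2.-1.

Fixpoint words (n : nat) : seq (seq bool) :=
  if n is m.+1 then
    [seq rcons s false | s <- words m] ++
    [seq rcons s true | s <- words m & free_letter s]
  else [:: [::]].

Lemma size_mem_words n s : s \in words n -> size s = n.
Proof.
elim: n s => [|n IHn] s /=; first by rewrite inE => /eqP->.
rewrite mem_cat => /orP[] /mapP[t tn ->]; rewrite size_rcons (IHn t)//.
by move: tn; rewrite mem_filter => /andP[].
Qed.

Lemma uniq_words n : uniq (words n).
Proof.
elim: n => //= n IHn.
rewrite cat_uniq !(map_inj_uniq (@rcons_injl _ _)) IHn filter_uniq //= andbT.
 apply/hasPn => _ /mapP[t _ ->].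
by apply/mapP => -[u _ /(congr1 (last false))]; rewrite !last_rcons.
Qed.

Definition admissible (x : nat -> bool) (n : nat) :=
  forall k, 0 < k -> 2 * k <= n -> ~~ (x k.-1 && x (2 * k).-1).

Lemma admissible_mkseq x n : admissible x n -> mkseq x n \in words n.
Proof.
elim: n => // n IHn xn.
have {}IHn : mkseq x n \in words n by apply: IHn => k k0 kn; apply: xn => //; lia.
rewrite mkseqS /= mem_cat; case xnE: (x n); last first.
  by rewrite (map_f (fun s => rcons s false)).
apply/orP; right; apply: (map_f (fun s => rcons s true)).
rewrite mem_filter IHn andbT /free_letter.
rewrite size_mkseq; case: (boolP (odd n.+1)) => [//|on].
have e : n.+1 = 2 * n.+1./2 by rewrite mul2n -[LHS]odd_double_half (negPf on).
have k0 : 0 < n.+1./2 by lia.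
rewrite nth_mkseq; last by lia.
by have := xn n.+1./2 k0; rewrite -e leqnn /= xnE andbT => ->.
Qed.

Lemma words_admissible n s : s \in words n -> admissible (nth false s) (size s).
Proof.
elim: n s => [|n IHn] s /=; first by rewrite inE => /eqP-> k /=; lia.
rewrite mem_cat => /orP[] /mapP[t tn ->] k k0; rewrite size_rcons => kt.
  have [kt'|kt'] := leqP (2 * k) (size t).
    have [k1 k2] : k.-1 < size t /\ (2 * k).-1 < size t by lia.
    by rewrite !nth_rcons k1 k2; exact: IHn.
  (* The appended letter is [false], and so is the default of [nth], hence both branches left by
     [nth_rcons] agree. *)
  have k2 : ((2 * k).-1 < size t) = false by lia.
  by rewrite [nth _ (rcons t _) (2 * k).-1]nth_rcons k2 if_same andbF.
move: tn; rewrite mem_filter => /andP[ft tn].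
have [kt'|kt'] := leqP (2 * k) (size t).
  have [k1 k2] : k.-1 < size t /\ (2 * k).-1 < size t by lia.
    by rewrite !nth_rcons k1 k2; exact: IHn.
have e : 2 * k = (size t).+1 by apply/eqP; rewrite eqn_leq kt kt'.
move: ft; rewrite /free_letter -e oddM /= mul2n doubleK.
have k1 : k.-1 < size t by lia.
by rewrite nth_rcons k1 => /negPf->.
Qed.

(** Acts as a partition function: unit weights count the words, and general weights let the last
    letter be summed out with its effect stored at an earlier coordinate. *)
Definition weight_sum (n : nat) (w : nat -> bool -> nat) : nat :=
  \sum_(s <- words n) \prod_(i < n) w i.+1 (nth false s i).

Lemma weight_sum1 n : weight_sum n (fun _ _ => 1) = size (words n).
Proof.
rewrite /weight_sum (eq_bigr (fun=> 1)) ?sum1_size// => s _.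
by rewrite big1.
Qed.

Lemma eq_weight_sum n w w' :
  (forall k b, 0 < k <= n -> w k b = w' k b) -> weight_sum n w = weight_sum n w'.
Proof.
by move=> ww'; apply: eq_bigr => s _; apply: eq_bigr => i _; apply: ww' => /=.
Qed.

Lemma weight_sumS n w : weight_sum n.+1 w =
  \sum_(s <- words n) (\prod_(i < n) w i.+1 (nth false s i)) *
    (w n.+1 false + free_letter s * w n.+1 true).
Proof.
rewrite /weight_sum /= big_cat /= !big_map big_filter /=.
rewrite [X in _ + X]big_mkcond -big_split /=; apply: eq_big_seq => s sn.
have sE := size_mem_words sn.
have recr b : \prod_(i < n.+1) w i.+1 (nth false (rcons s b) i) =
    (\prod_(i < n) w i.+1 (nth false s i)) * w n.+1 b.
  rewrite big_ord_recr /= nth_rcons sE ltnn eqxx; congr (_ * _).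
  by apply: eq_bigr => i _; rewrite nth_rcons sE ltn_ord.
by rewrite !recr mulnDr; case: free_letter; rewrite ?mul1n // !muln0.
Qed.

Lemma weight_sumS_odd n w : odd n.+1 ->
  weight_sum n.+1 w = weight_sum n w * (w n.+1 false + w n.+1 true).
Proof.
move=> on; rewrite weight_sumS /weight_sum big_distrl /=.
apply: eq_big_seq => s /size_mem_words sE.
by rewrite /free_letter sE on /= mul1n.
Qed.

(* Summing over the last letter of a word of even length [2 * k] turns the
   weights of its parent [k] into those returned here. *)
Definition absorb (w : nat -> bool -> nat) (k i : nat) (b : bool) : nat :=
  w i b * (if i == k then w (2 * k) false + ~~ b * w (2 * k) true else 1).

Lemma weight_sumS_even n w k : n.+1 = 2 * k ->
  weight_sum n.+1 w = weight_sum n (absorb w k).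
Proof.
move=> nk; rewrite weight_sumS /weight_sum.
apply: eq_big_seq => s /size_mem_words sE.
have kn : k.-1 < n by lia.
rewrite big_split /=; congr (_ * _).
(* Only coordinate [k], stored at index [k.-1], can carry an extra factor other than 1. *)
rewrite (bigD1 (Ordinal kn)) //= big1 ?muln1 => [|i ik].
  by rewrite prednK ?eqxx /free_letter ?sE ?nk ?oddM ?mul2n ?doubleK//; lia.
by case: eqP => // e; move: ik; rewrite -val_eqE /= -e eqxx.
Qed.

(** Cutting at [j < n] loses nothing for [k > 0], as [j < 2 ^ j]; a range independent of [k] permits
    the later exchange of sums. *)
Definition chain_length (n k : nat) : nat := \sum_(0 <= j < n) (2 ^ j * k <= n).

Lemma chain_length_half n k : 0 < k <= n ->
  chain_length n k = (chain_length n (2 * k)).+1.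
Proof.
case: n => [|n] kn; first by lia.
rewrite /chain_length big_nat_recl // mul1n (_ : k <= n.+1); last by lia.
(* The surplus last term on the right vanishes because [n.+1 < 2 ^ n.+1]. *)
rewrite [in RHS]big_nat_recr //= (_ : _ <= _ = false) ?addn0 ?add1n; last first.
  have := @ltn_expl 2 n.+1 isT; rewrite expnS.
  by move: (2 ^ n) => p; nia.
by congr _.+1; apply: eq_bigr => j _; rewrite expnS [2 * _]mulnC mulnA.
Qed.

Lemma chain_length_gt n k : n < k -> chain_length n k = 0.
Proof.
move=> nk; rewrite /chain_length big1 // => j _.
by rewrite leqNgt (leq_trans nk) // leq_pmull // expn_gt0.
Qed.

(** Splits on the first letter of a chain of [l.+1] coordinates: [true] also forces the next letter,
    if any, to be [false]. The case [l = 0] relies on [0.-1 = 0] and gives the two fillings of a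
    single coordinate. *)
Lemma fibo_recl l : fibo l + fibo l.-1 = fibo l.+1.
Proof. by case: l. Qed.

(* [chain_weight n m k b] counts the admissible ways of filling the coordinates
   2k, 4k, ... not exceeding n when coordinate k holds b, provided that
   these coordinates are larger than m. *)
Definition chain_weight (n m k : nat) (b : bool) : nat :=
  if 2 * k <= m then 1
  else if b then fibo (chain_length n (2 * k)).-1
  else fibo (chain_length n (2 * k)).

(** Letters are summed out from the right, down to [m]: an even coordinate passes its count to its
    half, while an odd one heads its chain and releases the factor of the whole chain. *)
Lemma weight_sum_chain n m : m <= n ->
  weight_sum n (fun _ _ => 1) =
  weight_sum m (chain_weight n m) *
  \prod_(m.+1 <= i < n.+1 | odd i) fibo (chain_length n i).
Proof.
move=> mn; rewrite -(subKn mn).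
elim: (n - m) (leq_subr m n) => {m mn} [_|d IHd dn].
  rewrite subn0 big_geq // muln1; apply: eq_weight_sum => k b kn.
  rewrite /chain_weight; case: ifP => // kn'.
  by rewrite chain_length_gt ?if_same //; lia.
rewrite {}IHd ?(ltnW dn)//.
have -> : n - d = (n - d.+1).+1 by lia.
have : n - d.+1 < n by lia.
move: (n - d.+1) => m mn {d dn}.
(* Lowering the threshold affects only the half of [m.+1]. *)
have eq_m k b : m.+1 != 2 * k -> chain_weight n m.+1 k b = chain_weight n m k b.
  by move=> mk; rewrite /chain_weight leq_eqVlt eq_sym (negPf mk) ltnS.
rewrite [in RHS]big_ltn_cond ?ltnS //; case: ifP => om.
  rewrite weight_sumS_odd // -mulnA; congr (_ * (_ * _)).
    by apply: eq_weight_sum => k b _; apply: eq_m; apply/eqP; lia.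
  have m2 : (2 * m.+1 <= m.+1) = false by lia.
  by rewrite /chain_weight m2 fibo_recl -chain_length_half; last lia.
have e : m.+1 = 2 * m.+1./2 by rewrite mul2n -[LHS]odd_double_half om.
rewrite (weight_sumS_even _ e); congr (_ * _).
apply: eq_weight_sum => k b km; rewrite /absorb.
case: eqP => [kE|kE]; last by rewrite muln1 eq_m // e; lia.
have {}e : m.+1 = 2 * k by rewrite e kE.
(* A [true] at [k] forces [false] at [2 * k]; a [false] at [k] allows both letters, whose weights
   are joined by [fibo_recl]. *)
have [c1 c2] : (2 * (2 * k) <= m.+1) = false /\ (2 * k <= m) = false by lia.
rewrite -kE /chain_weight c1 c2 e leqnn mul1n.
rewrite (@chain_length_half n (2 * k)) /=; last by lia.
by case: b; rewrite ?mul0n ?addn0 ?mul1n ?fibo_recl.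
Qed.

Lemma size_words n :
  size (words n) = \prod_(1 <= i < n.+1 | odd i) fibo (chain_length n i).
Proof.
rewrite -weight_sum1 (@weight_sum_chain n 0) // /weight_sum /= big_seq1.
by rewrite big_ord0 mul1n.
Qed.

(** These are the chains with more than [j] elements; their heads are the odd numbers up to
    [n %/ 2 ^ j]. *)
Lemma sum_odd_chain n j :
  \sum_(1 <= i < n.+1 | odd i) (2 ^ j * i <= n) = uphalf (n %/ 2 ^ j).
Proof.
have half m : \sum_(1 <= i < m.+1 | odd i) 1 = uphalf m.
  elim: m => [|m IHm]; first by rewrite big_geq.
  rewrite big_mkcond big_nat_recr //= -big_mkcond IHm /= uphalf_half.
  by case: (odd m) => /=; lia.
have p0 : 0 < 2 ^ j by rewrite expn_gt0.
rewrite -half [RHS](big_nat_widen _ _ n.+1) ?ltnS ?leq_div // [RHS]big_mkcondr /=.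
by apply: eq_bigr => i _; rewrite ?ltnS leq_divRL // mulnC; case: leqP.
Qed.

End words.

(** * Growth of the number of words *)

Section fibonacci_logs.
Context (R : realType).
Implicit Types (n j J : nat).

Definition lnfib j : R := ln (fibo j)%:R.

Lemma fibo_gt0 j : (0 < fibo j)%N.
Proof.
suff: (0 < fibo j)%N /\ (0 < fibo j.+1)%N by case.
by elim: j => //= j [j0 j1]; split=> //; rewrite addn_gt0 j1.
Qed.

Lemma leq_fiboS j : (fibo j <= fibo j.+1 <= 2 * fibo j)%N.
Proof.
case: j => // j; have := leq_addr (fibo j) (fibo j.+1).
suff: (fibo j <= fibo j.+1)%N by rewrite /=; lia.
by case: j => //= j; lia.
Qed.

Lemma fiboR_gt0 j : 0 < (fibo j)%:R :> R.
Proof. by rewrite ltr0n fibo_gt0. Qed.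

Lemma lnfib0 : lnfib 0 = 0.
Proof. by rewrite /lnfib ln1. Qed.

Lemma lnfib_ge0 j : 0 <= lnfib j.
Proof. by rewrite ln_ge0 // ler1n fibo_gt0. Qed.

Lemma ln2_gt0 : 0 < ln 2 :> R.
Proof. by rewrite ln_gt0 // ltr1n. Qed.

Lemma ln2_le1 : ln 2 <= 1 :> R.
Proof. by have := @le_ln1Dx R 1; rewrite -[1 + 1]/(2%:R); apply; lra. Qed.

Definition dlnfib j : R := lnfib j.+1 - lnfib j.

Lemma dlnfib_ge0 j : 0 <= dlnfib j.
Proof.
rewrite subr_ge0 ler_ln ?posrE ?fiboR_gt0 // ler_nat.
by have /andP[] := leq_fiboS j.
Qed.

Lemma dlnfib_le j : dlnfib j <= ln 2.
Proof.
rewrite lerBlDr -lnM ?posrE ?fiboR_gt0 //.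
rewrite ler_ln ?posrE ?mulr_gt0 ?fiboR_gt0 // -natrM ler_nat.
by have /andP[] := leq_fiboS j.
Qed.

Lemma dlnfib_le1 j : dlnfib j <= 1.
Proof. exact: le_trans (dlnfib_le j) ln2_le1. Qed.

Lemma lnfib_le j : lnfib j <= j%:R * ln 2.
Proof.
elim: j => [|j IHj]; first by rewrite lnfib0 mul0r.
by have := dlnfib_le j; rewrite /dlnfib -natr1; lra.
Qed.

(* [g] is the indicator of an initial segment, so that the sum telescopes. *)
Lemma sum_dlnfib_indicator n (g : nat -> bool) :
  (forall i j, (i <= j)%N -> g j -> g i) ->
  \sum_(0 <= j < n) dlnfib j * (g j)%:R = lnfib (\sum_(0 <= j < n) g j)%N.
Proof.
move=> gP; elim: n => [|n IHn]; first by rewrite !big_geq // lnfib0.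
rewrite !big_nat_recr //=; case: (boolP (g n)) => gn; last first.
  by rewrite mulr0 addr0 addn0.
rewrite (eq_big_nat _ _ (F2 := dlnfib)) => [|j jn]; last first.
  by rewrite (gP j n) ?mulr1 //; lia.
rewrite telescope_sumr // lnfib0 subr0 mulr1 /dlnfib addrC subrK.
rewrite (eq_big_nat _ _ (F2 := fun=> 1%N)) => [|j jn]; last by rewrite (gP j n) //; lia.
by rewrite sum_nat_const_nat subn0 muln1 addn1.
Qed.

Lemma ln_prodn (I : Type) (r : seq I) (P : pred I) (F : I -> nat) :
  (forall i, P i -> 0 < F i)%N ->
  ln (\prod_(i <- r | P i) F i)%N%:R = \sum_(i <- r | P i) ln (F i)%:R :> R.
Proof.
move=> F0; rewrite natr_prod.
(* Positivity is carried through the induction because [lnM] needs it. *)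
suff [] : 0 < \prod_(i <- r | P i) (F i)%:R :> R /\
  ln (\prod_(i <- r | P i) (F i)%:R) = \sum_(i <- r | P i) ln (F i)%:R :> R by [].
elim: r => [|i r [IH0 IH]]; first by rewrite !big_nil ln1.
rewrite !big_cons; case: ifP => // /F0 Fi.
by rewrite mulr_gt0 ?ltr0n // lnM ?posrE ?ltr0n // IH.
Qed.

Lemma ln_size_words n : ln (size (words n))%:R =
  \sum_(0 <= j < n) dlnfib j * (uphalf (n %/ 2 ^ j))%:R.
Proof.
rewrite size_words ln_prodn => [|i _]; last exact: fibo_gt0.
under [RHS]eq_bigr => j _ do rewrite -sum_odd_chain natr_sum mulr_sumr.
rewrite exchange_big /=; apply: eq_bigr => i _.
rewrite sum_dlnfib_indicator // => j k jk.
by apply: leq_trans; rewrite leq_mul // leq_pexp2l.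
Qed.

(** The coefficient of [dlnfib j] is the limit of [uphalf (n %/ 2 ^ j)] divided by [n]. *)
Definition dsum J : R := \sum_(0 <= j < J) dlnfib j / 2 ^+ j.+1.

(** With [q] the integer quotient, both [2 * uphalf q] and the exact [n / 2 ^ j] lie between [q] and
    [q + 1]. *)
Lemma uphalf_divn_dist n j :
  `|(uphalf (n %/ 2 ^ j))%:R - n%:R / 2 ^+ j.+1| <= 1 / 2 :> R.
Proof.
have p0 : (0 < 2 ^ j)%N by rewrite expn_gt0.
have p0R : 0 < 2 ^+ j :> R by rewrite exprn_gt0.
have lb : (n%:R : R) < ((n %/ 2 ^ j)%:R + 1) * 2 ^+ j.
  by rewrite natr1 -natrX -natrM ltr_nat -ltn_divLR.
have ub : (n %/ 2 ^ j)%:R * 2 ^+ j <= n%:R :> R.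
  by rewrite -natrX -natrM ler_nat leq_trunc_div.
rewrite -ltr_pdivrMr // in lb; rewrite -ler_pdivlMr // in ub.
have h : (2 * uphalf (n %/ 2 ^ j) <= (n %/ 2 ^ j).+1)%N by lia.
have h' : (n %/ 2 ^ j <= 2 * uphalf (n %/ 2 ^ j))%N by lia.
rewrite -(ler_nat R) natrM -natr1 in h; rewrite -(ler_nat R) natrM in h'.
rewrite exprS invfM mulrCA ler_norml; apply/andP; split; lra.
Qed.

Lemma geometric_tail_le J n : (J <= n)%N ->
  \sum_(J <= j < n) (2 ^+ j)^-1 <= 2 / 2 ^+ J - 2 / 2 ^+ n :> R.
Proof.
elim: n => [|n IHn]; first by rewrite leqn0 => /eqP->; rewrite big_geq // subrr.
rewrite leq_eqVlt => /orP[/eqP->|]; first by rewrite big_geq // subrr.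
rewrite ltnS => Jn; rewrite big_nat_recr //=.
by have := IHn Jn; rewrite exprS invfM mulrA mulfV // mul1r; lra.
Qed.

(** Each of the first [J] terms is off by at most 1. The others are nonnegative and at most
    [n / 2 ^ j], so a geometric tail bounds them. *)
Lemma ln_size_words_dist n J : (J <= n)%N ->
  `|ln (size (words n))%:R - n%:R * dsum J| <= J%:R + n%:R * (2 / 2 ^+ J) :> R.
Proof.
move=> Jn; rewrite ln_size_words (big_cat_nat (n := J)) //=.
rewrite addrAC; apply: le_trans (ler_normD _ _) _; apply: lerD.
  rewrite /dsum mulr_sumr -sumrB; apply: le_trans (ler_norm_sum _ _ _) _.
  rewrite -[J in leRHS]subn0 -sumr_const_nat; apply: ler_sum => j _.
  rewrite mulrCA -mulrBr normrM -[leRHS]mulr1 ler_pM //.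
    by rewrite ger0_norm ?dlnfib_ge0 ?dlnfib_le1.
  by apply: le_trans (uphalf_divn_dist n j) _; lra.
rewrite ger0_norm; last by apply: sumr_ge0 => j _; rewrite mulr_ge0 ?dlnfib_ge0.
apply: (@le_trans _ _ (\sum_(J <= j < n) n%:R * (2 ^+ j)^-1)).
  apply: ler_sum => j _; rewrite -[leRHS]mul1r.
  rewrite ler_pM ?dlnfib_ge0 ?dlnfib_le1 // ler_pdivlMr ?exprn_gt0 //.
  rewrite -natrX -natrM ler_nat (leq_trans _ (leq_trunc_div n (2 ^ j))) //.
  have h : (uphalf (n %/ 2 ^ j) <= n %/ 2 ^ j)%N by move: (n %/ _)%N => m; lia.
  by rewrite leq_mul2r h orbT.
rewrite -mulr_sumr ler_wpM2l //.
apply: le_trans (geometric_tail_le Jn) _.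
by rewrite gerBl divr_ge0 // exprn_ge0.
Qed.

(** * The logarithmic series and the limiting growth rate *)

Definition fibsum N : R := \sum_(1 <= n < N.+1) ln (fibo n)%:R / 2 ^+ n.

Lemma fibsumS N : fibsum N.+1 = fibsum N + lnfib N.+1 / 2 ^+ N.+1.
Proof. by rewrite /fibsum big_nat_recr. Qed.

Lemma fibsum_nondecreasing : nondecreasing_seq fibsum.
Proof.
apply/nondecreasing_seqP => N; rewrite fibsumS lerDl.
by rewrite divr_ge0 ?lnfib_ge0 ?exprn_ge0.
Qed.

(** The added term is the exact tail of [j * ln 2 / 2 ^ j] over [j > N], which dominates the series
    by [lnfib_le]. *)
Lemma fibsum_tail_nonincreasing :
  nonincreasing_seq (fun N => fibsum N + (N%:R + 2) * ln 2 / 2 ^+ N).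
Proof.
apply/nonincreasing_seqP => N; rewrite fibsumS -addrA lerD2l -mulrDl.
rewrite exprS invfM mulrA ler_pM2r ?invr_gt0 ?exprn_gt0 //.
by have := lnfib_le N.+1; rewrite -natr1; lra.
Qed.

(** Both sides are compared at [maxn N M]: partial sums increase up to there, corrected sums
    decrease. *)
Lemma fibsum_le N M :
  fibsum N <= fibsum M + (M%:R + 2) * ln 2 / 2 ^+ M.
Proof.
have tail0 K : 0 <= (K%:R + 2) * ln 2 / 2 ^+ K :> R.
  by rewrite !mulr_ge0 ?addr_ge0 ?invr_ge0 ?exprn_ge0 // ltW ?ln2_gt0.
apply: le_trans (fibsum_nondecreasing (leq_maxl N M)) _.
apply: le_trans (fibsum_tail_nonincreasing (leq_maxr N M)).
by rewrite lerDl.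
Qed.

Lemma cvg_fibsum : cvgn fibsum.
Proof.
apply: nondecreasing_is_cvgn; first exact: fibsum_nondecreasing.
by exists (fibsum 0 + (0%:R + 2) * ln 2 / 2 ^+ 0) => _ [N _ <-]; exact: fibsum_le.
Qed.

(** Summation by parts; the boundary term vanishes as [lnfib 0 = 0]. *)
Lemma dsumS J : dsum J.+1 = fibsum J.+1 - fibsum J / 2.
Proof.
elim: J => [|J IHJ].
  rewrite /dsum /fibsum !big_nat1 [X in _ - X / 2]big_geq //.
  by rewrite /dlnfib lnfib0 subr0 mul0r subr0.
rewrite /dsum big_nat_recr //= -/(dsum _) IHJ (fibsumS J.+1) (fibsumS J).
rewrite /dlnfib 2!exprS exprS !invfM.
set p := (2 ^+ J)^-1; lra.
Qed.

Lemma cvg_dsum : dsum @ \oo --> limn fibsum / 2.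
Proof.
rewrite -cvg_shiftS (_ : _ / 2 = limn fibsum - limn fibsum / 2); last by lra.
have cS := cvg_fibsum.
rewrite (_ : [sequence _]_n = fun n => fibsum n.+1 - fibsum n / 2); last first.
  by apply/funext => n; exact: dsumS.
apply: cvgB; first by rewrite (cvg_shiftS fibsum).
by apply: cvgMl; exact: cS.
Qed.

Lemma cvg_ln_size_words :
  ln (size (words n))%:R / n%:R @[n --> \oo] --> limn fibsum / 2.
Proof.
apply/cvgrPdist_le => e e0.
have e40 : 0 < e / 4 by lra.
(* The cut [J0] is fixed first, leaving two errors of [e / 4]; a large [n] then makes [J0 / n] at
   most [e / 2]. *)
have : \forall J \near \oo, `|limn fibsum / 2 - dsum J| <= e / 4 /\
    `|0 - geometric 2 (2^-1) J| <= e / 4.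
  apply: filterS2 (fun _ h1 h2 => conj h1 h2) _ _.
    by move/cvgrPdist_le : cvg_dsum; exact.
  have : `|2^-1| < 1 :> R by rewrite ger0_norm //; lra.
  by move=> /(cvg_geometric 2)/cvgrPdist_le; exact.
case=> J0 _ /(_ J0 (leqnn _)) /= [hD hG].
near=> n.
have Jn : (J0 <= n)%N by near: n; exact: nbhs_infty_ge.
have n0 : 0 < n%:R :> R by rewrite ltr0n; near: n; exact: nbhs_infty_gt.
have Jne : J0%:R <= e / 2 * n%:R.
  rewrite mulrC -ler_pdivrMr; last by lra.
  by near: n; exact: nbhs_infty_ger.
have := ln_size_words_dist Jn.
rewrite sub0r normrN exprVn ger0_norm in hG; last by rewrite divr_ge0 ?exprn_ge0.
set B := ln _; set D := dsum _ in hD *; set G := 2 / _ in hG *.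
move=> hB.
have hBn : `|B / n%:R - D| <= e / 2 + G.
  rewrite -(ler_pM2r n0) -[X in _ * X <= _](gtr0_norm n0) -normrM mulrBl.
  by rewrite divfK ?gt_eqF // [D * _]mulrC mulrDl [G * _]mulrC; lra.
by move: hD hBn; rewrite !ler_norml => /andP[? ?] /andP[? ?]; lra.
Unshelve. all: by end_near.
Qed.

End fibonacci_logs.

(** * Covering numbers and box dimension *)

Section cover.
Context (R : realType).
Implicit Types (x y : binseq R) (n : nat).

Lemma rho_le x y n : (forall k, (k < n)%N -> x k = y k) -> rho x y <= 2 ^- n.+1.
Proof.
move=> xy; rewrite /rho; case: pselect => [h|_]; last by rewrite invr_ge0 exprn_ge0.
case: ex_minnP => m /andP[m0 xym] _.
rewrite lef_pV2 ?posrE ?exprn_gt0 // ler_eXn2l ?ltr1n // ltnNge.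
by apply: contra xym => mn; rewrite /nth_coord xy //; lia.
Qed.

Definition word_cylinder n (i : 'I_(size (words n))) : set (binseq R) :=
  [set x | mkseq x n = nth [::] (words n) i].

Lemma X0_admissible x n : X0 x -> admissible x n.
Proof.
move=> x0 k k0 _; have := x0 k k0.
by rewrite /nth_coord; case: (x k.-1); case: (x _).
Qed.

(** The default of [nth] pads the word with zeros, which creates no forbidden pair. *)
Lemma X0_word n s : s \in words n -> X0 (nth false s : binseq R).
Proof.
move=> sn k k0; rewrite /nth_coord.
have [ks|ks] := leqP (2 * k) (size s).
  by have := words_admissible sn k0 ks; case: (nth _ _ _); case: (nth _ _ _).
by rewrite [nth _ _ (2 * k).-1]nth_default ?muln0 // -ltnS prednK // muln_gt0.
Qed.

(** Cylinders give the upper bound. For the lower one, zero-padded words must fall into pairwise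
    different sets of any cover. *)
Lemma cover_number_X0 n (d : R) : 2 ^- n.+1 <= d < 2 ^- n ->
  cover_number (@X0 R) d = (size (words n))%:R%:E.
Proof.
move=> /andP[nd dn]; apply/eqP; rewrite eq_le; apply/andP; split.
  apply: ereal_inf_lbound; exists (size (words n)) => //.
  exists (@word_cylinder n); split=> [i x y xi yi|x x0].
    apply: le_trans nd; apply: rho_le => k kn.
    by rewrite -(nth_mkseq false x kn) xi -yi nth_mkseq.
  have xn := admissible_mkseq (X0_admissible (n := n) x0).
  have := xn; rewrite -index_mem => ix.
  by exists (Ordinal ix) => //; rewrite /word_cylinder /= nth_index.
apply: le_ereal_inf_tmp => _ [m [U [Ud XU]] <-].
rewrite lee_fin ler_nat.
(* Stated for all [s] so that [choice] applies; outside [words n] the index covering the zero word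
   serves as a dummy. *)
have inU s : exists i : 'I_m, s \in words n -> U i (nth false s).
  case: (boolP (s \in words n)) => [sn|_].
    by have [i _ ?] := XU _ (X0_word sn); exists i.
  have [s0] : exists s0, s0 \in words n.
    exists (mkseq xpred0 n).
    by apply: admissible_mkseq => k _ _ /=.
  by move=> /X0_word/XU[i _ _]; exists i.
have {inU} [f fU] := choice inU.
have finj : {in words n &, injective f}.
  move=> s t sn tn fst; apply: (@eq_from_nth _ false).
    by rewrite (size_mem_words sn) (size_mem_words tn).
  move=> i; rewrite (size_mem_words sn) => i_n; apply/eqP/negPn/negP => st.
  have Ut : U (f s) (nth false t) by rewrite fst; exact: fU.
  have st_d := Ud (f s) _ _ (fU s sn) Ut.
  have : differ_at (nth false s : binseq R) (nth false t) i.+1.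
    by rewrite /differ_at /nth_coord.
  move=> /rho_ge; rewrite leNgt => /negP; apply.
  apply: le_lt_trans st_d _; apply: lt_le_trans dn _.
  by rewrite lef_pV2 ?posrE ?exprn_gt0 // ler_eXn2l ?ltr1n.
rewrite -(size_map f) -[leqRHS]card_ord.
have /card_uniqP <- : uniq [seq f s | s <- words n].
  by rewrite map_inj_in_uniq // uniq_words.
exact: max_card.
Qed.

Lemma size_words_gt0 n : (0 < size (words n))%N.
Proof.
rewrite -has_predT; apply/hasP; exists (mkseq xpred0 n) => //.
by apply: admissible_mkseq => k _ _ /=.
Qed.

End cover.

(** * From dyadic scales to all small radii *)

Section box_dim_X0.
Context (R : realType).

Lemma dyadic_scale (d : R) : 0 < d < 1 -> exists n, 2 ^- n.+1 <= d < 2 ^- n.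
Proof.
move=> /andP[d0 d1].
have ex : exists n, 2 ^- n.+1 <= d.
  (* With [t] the integer part of [d^-1], one has [d^-1 < t.+1 < 2 ^ t.+1]. *)
  exists (Num.truncn d^-1); rewrite -[leRHS]invrK lef_pV2 ?posrE ?invr_gt0 ?exprn_gt0 //.
  apply/ltW/(lt_le_trans (truncnS_gt _)).
  by rewrite -natrX ler_nat; apply: ltnW; exact: ltn_expl.
case: (ex_minnP ex) => -[|n] nd nmin; first by exists 0; rewrite nd expr0 invr1.
exists n.+1; rewrite nd ltNge; apply/negP => /nmin.
by rewrite ltnn.
Qed.

(** Supplies the other side of the squeeze, as [- ln d] runs between [n * ln 2] and [n.+1 * ln 2] at
    scale [n]. *)
Lemma cvg_ln_size_words_succ :
  ln (size (words n))%:R / n.+1%:R @[n --> \oo] --> limn (@fibsum R) / 2.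
Proof.
have -> : (fun n => ln (size (words n))%:R / n.+1%:R) =
    (fun n => ln (size (words n))%:R / n%:R * (1 - harmonic n)) :> (nat -> R).
  (* At [n = 0] the division by zero is harmless: there is one empty word, with logarithm 0. *)
  apply/funext => -[|n]; first by rewrite /= ln1 !mul0r.
  rewrite /harmonic /=; have n0 : n.+1%:R != 0 :> R by rewrite pnatr_eq0.
  have n1 : n.+2%:R != 0 :> R by rewrite pnatr_eq0.
  by move: n0 n1; rewrite -[n.+2%:R]natr1; move: n.+1%:R => x x0 x1; field; rewrite x0 x1.
rewrite -[X in _ --> X]mulr1 -[X in _ * X]subr0.
apply: cvgM; first exact: cvg_ln_size_words.
by apply: cvgB; [exact: cvg_cst | exact: cvg_harmonic].
Qed.

Lemma has_box_dim_X0 :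
  has_box_dim (@X0 R) (1 / (2 * ln 2) * limn (@fibsum R))%:E.
Proof.
have ln2p := ln2_gt0 R.
(* For [0 < d < 1] the covering number is finite and positive, so the limit can be taken in [R]. *)
pose f (d : R) := fine (lne (cover_number (@X0 R) d)) * (- ln d)^-1.
have fE n d : 2 ^- n.+1 <= d < 2 ^- n ->
    lne (cover_number (@X0 R) d) = (ln (size (words n))%:R)%:E.
  by move=> nd; rewrite (cover_number_X0 nd) lne_EFin // ltr0n size_words_gt0.
apply: (@cvg_trans _ ((f d)%:E @[d --> 0^'+])).
  apply: near_eq_cvg; near=> d.
  have /dyadic_scale[n nd] : 0 < d < 1.
    by apply/andP; split; near: d; [exact: nbhs_right_gt | exact: nbhs_right_lt].
  by rewrite /f (fE _ _ nd) -EFinM.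
apply: cvg_EFin; first by near=> d.
rewrite [fine \o _](_ : _ = f) //.
have -> : 1 / (2 * ln 2) * limn (@fibsum R) = limn (@fibsum R) / 2 / ln 2.
  by field; rewrite gt_eqF.
apply/cvgrPdist_le => e e0.
have el0 : 0 < e * ln 2 by rewrite mulr_gt0.
have [N _ HN] : \forall n \near \oo,
    `|limn (@fibsum R) / 2 - ln (size (words n))%:R / n%:R| <= e * ln 2 /\
    `|limn (@fibsum R) / 2 - ln (size (words n))%:R / n.+1%:R| <= e * ln 2.
  apply: filterS2 (fun _ h1 h2 => conj h1 h2) _ _.
    by move/cvgrPdist_le : (@cvg_ln_size_words R); exact.
  by move/cvgrPdist_le : cvg_ln_size_words_succ; exact.
near=> d.
have /andP[d0 d1] : 0 < d < 1.
  by apply/andP; split; near: d; [exact: nbhs_right_gt | exact: nbhs_right_lt].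
have dN : d < 2 ^- N.+1.
  by near: d; apply: nbhs_right_lt; rewrite invr_gt0 exprn_gt0.
have [|n nd] := @dyadic_scale d; first by rewrite d0 d1.
have Nn : (N < n)%N.
  case/andP: nd => nd _; have := le_lt_trans nd dN.
  by rewrite ltf_pV2 ?posrE ?exprn_gt0 // ltr_eXn2l ?ltr1n.
have /= := HN n (ltnW Nn).
rewrite /f (fE _ _ nd) /=.
have n0 : 0 < n%:R :> R by rewrite ltr0n; lia.
set b := ln _; have b0 : 0 <= b by rewrite ln_ge0 // ler1n size_words_gt0.
have lnd : n%:R * ln 2 <= - ln d <= n.+1%:R * ln 2.
  case/andP: nd => nd dn; rewrite -lnV ?posrE //.
  rewrite !mulr_natl -!lnXn //.
  rewrite !ler_ln ?posrE ?exprn_gt0 ?invr_gt0 //.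
  rewrite -[2 ^+ n]invrK -[2 ^+ n.+1]invrK !lef_pV2 ?posrE ?invr_gt0 ?exprn_gt0 //.
  by rewrite nd ltW.
case/andP: lnd; set L := - ln d => L1 L2.
have Lp : 0 < L by apply: lt_le_trans L1; rewrite mulr_gt0.
rewrite !ler_norml => -[/andP[h1 _] /andP[_ h2]].
(* After scaling by [ln 2], the quotient [b / L * ln 2] is squeezed between [b / n.+1] and
   [b / n]. *)
rewrite -![_ <= e](ler_pM2r ln2p) -[_ <= _ - _](ler_pM2r ln2p).
have u1 : b / L * ln 2 <= b / n%:R.
  by rewrite -mulrA ler_wpM2l // ler_pdivrMl // ler_pdivlMr // mulrC.
have u2 : b / n.+1%:R <= b / L * ln 2.
  by rewrite -mulrA ler_wpM2l // ler_pdivlMl // ler_pdivrMr ?ltr0n // mulrC.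
rewrite !mulrBl divfK ?gt_eqF // mulNr.
apply/andP; split.
  by apply: le_trans h1 _; rewrite lerD2l lerN2.
by apply: le_trans h2; rewrite lerD2l lerN2.
Unshelve. all: by end_near.
Qed.

End box_dim_X0.

(** * Decimal value *)

(* Floating-point evaluation of [\prod_(1 <= n < k.+1) fibo n ^ 2 ^ (k - n)],
   whose logarithm is [2 ^ k * fibsum k]: the pair [(m, e)] stands for
   [m * 2 ^ e]; the mantissa is cut to about 50 bits, rounding down for [r = 0]
   and up for [r = 1]. *)
Section numerics.
Local Open Scope N_scope.

Fixpoint fibN (k : nat) : N * N :=
  if k is k'.+1 then let: (a, b) := fibN k' in (b, a + b) else (1, 2).

(** Squaring doubles the logarithm, as in [fibsum_pow2S]. Subtraction in [N] stops at 0, so short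
    products are not shifted; adding [2 ^ s - 1] turns the floor into a ceiling. *)
Definition float_step (r : N) (x : N * N) (a : N) : N * N :=
  let: (m, e) := x in
  let q := m * m * a in
  let s := N.log2 q - 50 in
  ((q + r * (2 ^ s - 1)) / 2 ^ s, 2 * e + s).

Fixpoint float_prod (r : N) (k : nat) : N * N :=
  if k is k'.+1 then float_step r (float_prod r k') (fibN k').2 else (1, 0).

Lemma float_prodS r k :
  float_prod r k.+1 = float_step r (float_prod r k) (fibN k).2.
Proof. by []. Qed.

End numerics.

Section numeric_bounds.
Context (R : realType).

Definition NtoR (x : N) : R := (N.to_nat x)%:R.

Lemma NtoRD x y : NtoR (x + y)%num = NtoR x + NtoR y.
Proof. by rewrite /NtoR N2Nat.inj_add natrD. Qed.

Lemma NtoRM x y : NtoR (x * y)%num = NtoR x * NtoR y.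
Proof. by rewrite /NtoR N2Nat.inj_mul natrM. Qed.

Lemma NtoRX x y : NtoR (x ^ y)%num = NtoR x ^+ N.to_nat y.
Proof.
rewrite /NtoR N2Nat.inj_pow -natrX; congr _%:R.
by elim: (N.to_nat y) => //= n ->; rewrite expnS.
Qed.

Lemma NtoR_le x y : (x <= y)%num -> NtoR x <= NtoR y.
Proof. by move=> xy; rewrite ler_nat; lia. Qed.

Lemma NtoR_lt x y : (x < y)%num -> NtoR x < NtoR y.
Proof. by move=> xy; rewrite ltr_nat; lia. Qed.

Lemma NtoR_gt0 x : (0 < x)%num -> 0 < NtoR x.
Proof. by move=> /NtoR_lt. Qed.

Lemma ln_NtoR_pow2 s : ln (NtoR (2 ^ s)) = NtoR s * ln 2.
Proof. by rewrite NtoRX lnXn ?ltr0n // mulr_natl. Qed.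

Lemma fibNE k : N.to_nat (fibN k).1 = fibo k /\ N.to_nat (fibN k).2 = fibo k.+1.
Proof.
elim: k => //= k; case: (fibN k) => a b /= [aE bE].
by rewrite N2Nat.inj_add aE bE; split=> //; rewrite addnC.
Qed.

Lemma ln_NtoR_fibN k : ln (NtoR (fibN k).2) = lnfib R k.+1.
Proof. by rewrite /NtoR (fibNE k).2. Qed.

Lemma fibN_gt0 k : (0 < (fibN k).2)%num.
Proof. by have := (fibNE k).2; have := fibo_gt0 k.+1; lia. Qed.

Lemma fibsum_pow2S k : 2 ^+ k.+1 * fibsum R k.+1 =
  2 * (2 ^+ k * fibsum R k) + lnfib R k.+1.
Proof.
rewrite fibsumS mulrDr [2 ^+ k.+1 * (_ / _)]mulrC divfK ?expf_neq0 //.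
by rewrite exprS mulrA.
Qed.

Lemma float_prod_lower k : let: (m, e) := float_prod 0 k in
  (0 < m)%num /\ ln (NtoR m) + NtoR e * ln 2 <= 2 ^+ k * fibsum R k.
Proof.
elim: k => [|k].
  by split=> //; rewrite /fibsum big_geq // mulr0 mul0r addr0 [NtoR _]/(1%:R) ln1.
rewrite float_prodS.
case: (float_prod 0 k) => m e [m0 IH]; rewrite /float_step; lazy beta iota zeta.
have b0 := fibN_gt0 k; set q := (m * m * _)%num; set s := (_ - 50)%num.
have q0 : (0 < q)%num by rewrite /q; nia.
(* Hence the truncated mantissa stays positive and its logarithm is meaningful. *)
have sq : (2 ^ s <= q)%num.
  have [+ _] := N.log2_spec q q0; apply: N.le_trans.
  by apply: N.pow_le_mono_r => //; rewrite /s; lia.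
have p0 : (0 < 2 ^ s)%num by have := N.pow_nonzero 2 s; lia.
have m'0 : (0 < q / 2 ^ s)%num by apply: N.div_str_pos; split.
rewrite N.mul_0_l N.add_0_r; split => //.
have : NtoR (q / 2 ^ s * 2 ^ s)%num <= NtoR q.
  by apply: NtoR_le; rewrite N.mul_comm; apply: N.mul_div_le; lia.
rewrite -ler_ln ?posrE ?NtoR_gt0 //; last by nia.
rewrite NtoRM lnM ?posrE ?NtoR_gt0 // ln_NtoR_pow2 /q !NtoRM.
rewrite !lnM ?posrE ?mulr_gt0 ?NtoR_gt0 // ln_NtoR_fibN fibsum_pow2S.
by rewrite [NtoR (2 * e + s)%num]NtoRD NtoRM (_ : NtoR 2 = 2) //; lra.
Qed.

Lemma float_prod_upper k : let: (m, e) := float_prod 1 k in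
  (0 < m)%num /\ 2 ^+ k * fibsum R k <= ln (NtoR m) + NtoR e * ln 2.
Proof.
elim: k => [|k].
  by split=> //; rewrite /fibsum big_geq // mulr0 mul0r addr0 [NtoR _]/(1%:R) ln1.
rewrite float_prodS.
case: (float_prod 1 k) => m e [m0 IH]; rewrite /float_step; lazy beta iota zeta.
have b0 := fibN_gt0 k; set q := (m * m * _)%num; set s := (_ - 50)%num.
have q0 : (0 < q)%num by rewrite /q; nia.
have p0 : (0 < 2 ^ s)%num by have := N.pow_nonzero 2 s; lia.
rewrite N.mul_1_l; set m' := (_ / _)%num.
have qm' : (q <= m' * 2 ^ s)%num.
  have := N.mul_succ_div_gt (q + (2 ^ s - 1)) (2 ^ s); rewrite -/m'.
  by move: p0; move: (2 ^ s)%num => p p0 /(_ (N.neq_sym _ _ (N.lt_neq _ _ p0))); nia.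
have m'0 : (0 < m')%num by move: qm'; case: (m') => //; rewrite N.mul_0_l; lia.
split => //; have := NtoR_le qm'.
rewrite -ler_ln ?posrE ?NtoR_gt0 //; last by nia.
rewrite NtoRM lnM ?posrE ?NtoR_gt0 // ln_NtoR_pow2 /q !NtoRM.
rewrite !lnM ?posrE ?mulr_gt0 ?NtoR_gt0 // ln_NtoR_fibN fibsum_pow2S.
by rewrite [NtoR (2 * e + s)%num]NtoRD NtoRM (_ : NtoR 2 = 2) //; lra.
Qed.

(** Bounding [m] below by [2 ^ N.log2 m] leaves only an integer comparison to compute. *)
Lemma fibsum_ge (c : N) k :
  (let: (m, e) := float_prod 0 k in (c <=? e + N.log2 m)%num) ->
  NtoR c * ln 2 <= 2 ^+ k * fibsum R k.
Proof.
have := float_prod_lower k; case: (float_prod 0 k) => m e [m0 h] /N.leb_le/NtoR_le.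
rewrite NtoRD => hc.
have [/NtoR_le lm _] := N.log2_spec m m0.
rewrite -ler_ln ?posrE ?NtoR_gt0 // ?ln_NtoR_pow2 in lm; last first.
  by have := N.pow_nonzero 2 (N.log2 m); lia.
have := ler_wpM2r (ltW (ln2_gt0 R)) hc; lra.
Qed.

Lemma fibsum_le_pow2 (c : N) k :
  (let: (m, e) := float_prod 1 k in (e + N.log2 m + 1 <=? c)%num) ->
  2 ^+ k * fibsum R k <= NtoR c * ln 2.
Proof.
have := float_prod_upper k; case: (float_prod 1 k) => m e [m0 h] /N.leb_le/NtoR_le.
rewrite -N.add_assoc NtoRD N.add_1_r => hc.
have [_ /NtoR_lt/ltW lm] := N.log2_spec m m0.
rewrite -ler_ln ?posrE ?NtoR_gt0 // ?ln_NtoR_pow2 in lm; last first.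
  by have := N.pow_nonzero 2 (N.succ (N.log2 m)); lia.
have := ler_wpM2r (ltW (ln2_gt0 R)) hc; lra.
Qed.

End numeric_bounds.

Section value.
Context (R : realType).

Lemma NtoR_pow2 k : NtoR R (2 ^ N.of_nat k) = 2 ^+ k.
Proof. by rewrite NtoRX Nat2N.id (_ : NtoR R 2 = 2). Qed.

Lemma box_dim_ge (c : N) k :
  (let: (m, e) := float_prod 0 k in (c <=? e + N.log2 m)%num) ->
  NtoR R c / NtoR R (2 ^ N.of_nat k.+1) <= 1 / (2 * ln 2) * limn (@fibsum R).
Proof.
move=> /(fibsum_ge R) ck; have ln2p := ln2_gt0 R.
have Sk := nondecreasing_cvgn_le (@fibsum_nondecreasing R) (@cvg_fibsum R) k.
rewrite NtoR_pow2 mul1r ler_pdivlMl ?mulr_gt0 // mulrA ler_pdivrMr ?exprn_gt0 //.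
have p0 : 0 < 2 ^+ k :> R by rewrite exprn_gt0.
rewrite exprS; have := ler_wpM2l (ltW p0) Sk; lra.
Qed.

(** The summand [k + 2] is the tail bound [(k + 2) * ln 2 / 2 ^ k] of the series after scaling by
    [2 ^ k / ln 2]. *)
Lemma box_dim_le (c : N) k :
  (let: (m, e) := float_prod 1 k in (e + N.log2 m + 1 <=? c)%num) ->
  1 / (2 * ln 2) * limn (@fibsum R) <=
  NtoR R (c + N.of_nat k + 2) / NtoR R (2 ^ N.of_nat k.+1).
Proof.
move=> /(fibsum_le_pow2 R) ck; have ln2p := ln2_gt0 R.
have p0 : 0 < 2 ^+ k :> R by rewrite exprn_gt0.
have Sk : limn (@fibsum R) <= fibsum R k + (k%:R + 2) * ln 2 / 2 ^+ k.
  apply: limr_le; first exact: cvg_fibsum.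
  by apply: nearW => N; exact: fibsum_le.
rewrite NtoR_pow2 !NtoRD [NtoR R (N.of_nat k)]/NtoR Nat2N.id (_ : NtoR R 2 = 2) //.
rewrite mul1r ler_pdivrMl ?mulr_gt0 // mulrA ler_pdivlMr ?exprn_gt0 //.
have := ler_wpM2l (ltW p0) Sk.
rewrite mulrDr [2 ^+ k * (_ / _)]mulrC divfK ?gt_eqF // exprS; lra.
Qed.

Lemma NtoR_div_le a b c d : (0 < b)%num -> (0 < d)%num -> (a * d <= c * b)%num ->
  NtoR R a / NtoR R b <= NtoR R c / NtoR R d.
Proof.
move=> /(NtoR_gt0 R) b0 /(NtoR_gt0 R) d0 /(NtoR_le R); rewrite !NtoRM => h.
by rewrite ler_pdivrMr // mulrAC ler_pdivlMr.
Qed.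

Lemma NtoR_div_lt a b c d : (0 < b)%num -> (0 < d)%num -> (a * d < c * b)%num ->
  NtoR R a / NtoR R b < NtoR R c / NtoR R d.
Proof.
move=> /(NtoR_gt0 R) b0 /(NtoR_gt0 R) d0 /(NtoR_lt R); rewrite !NtoRM => h.
by rewrite ltr_pdivrMr // mulrAC ltr_pdivlMr.
Qed.

(** A single fraction of binary integers, so that the decimal bounds reduce to comparisons settled
    by [vm_compute]. *)
Lemma NtoR_decimal (a : N) : 824 / 10 ^+ 3 + NtoR R a / 10 ^+ 7 =
  NtoR R (824 * 10 ^ 4 + a) / NtoR R (10 ^ 7).
Proof.
rewrite NtoRD NtoRM !NtoRX (_ : NtoR R 824 = 824) // (_ : NtoR R 10 = 10) //.
rewrite (_ : N.to_nat 4 = 4%N) // (_ : N.to_nat 7 = 7%N) // (exprD _ 3 4).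
by field.
Qed.

(* The witnesses are [2 ^ 32 * fibsum 32 / ln 2] rounded down and up; the
   resulting bounds are 0.8242936028... and 0.8242936069... *)
Lemma box_dim_bounds : let dim : R := 1 / (2 * ln 2) * limn (@fibsum R) in
  824 / 10 ^+ 3 + 2936 / 10 ^+ 7 <= dim < 824 / 10 ^+ 3 + 2937 / 10 ^+ 7.
Proof.
have -> : 2936 = NtoR R 2936 by [].
have -> : 2937 = NtoR R 2937 by [].
rewrite !NtoR_decimal /=; apply/andP; split.
  apply: le_trans (@box_dim_ge 7080628133 32 _); last by vm_compute.
  by apply: NtoR_div_le => //; apply/N.leb_le; vm_compute.
apply: le_lt_trans (@box_dim_le 7080628134 32 _) _; first by vm_compute.
by apply: NtoR_div_lt => //; apply/N.ltb_lt; vm_compute.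
Qed.

End value.

Theorem theorem1p2 (R : realType) :
  let S : R^nat := fun N => \sum_(1 <= n < N.+1) ln (fibo n)%:R / 2 ^+ n in
  let dim : R := 1 / (2 * ln 2) * limn S in
  [/\ cvgn S,
      has_box_dim (@X0 R) dim%:E
    (* 0.8242936 <= dim < 0.8242937, written without large unary numerals *)
    & 824 / 10 ^+ 3 + 2936 / 10 ^+ 7 <= dim
        < 824 / 10 ^+ 3 + 2937 / 10 ^+ 7].
Proof.
split; [exact: cvg_fibsum | exact: has_box_dim_X0 | exact: box_dim_bounds].
Qed.
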